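(* Given $m\in\mathbb{N}$, for any $\epsilon<\frac{m-1}{m}$, the deterministic profile query complexity of finding $\epsilon$-approximate correlated equilibria of $n$-player, $m$-action games is $2^{\Omega(n)}$.
   Context: Games. An $n$-player, $m$-action game has players $[n]=\{1,\dots,n\}$, each with action set $[m]=\{1,\dots,m\}$, and payoff functions $u_i:[m]^n\to[0,1]$. Correlated equilibria. A correlated strategy profile is a probability distribution $\mathbf{X}\in\Delta([m]^n)$ over pure action profiles. For player $i$ and $\phi:[m]\to[m]$ let $u_i(\mathbf{X})=\mathbb{E}_{\mathbf{a}\sim\mathbf{X}}[u_i(\mathbf{a})]$ and $u_i^{(\phi)}(\mathbf{X})=\mathbb{E}_{\mathbf{a}\sim\mathbf{X}}[u_i(\phi(a_i),\mathbf{a}_{-i})]$, where $\mathbf{a}_{-i}$ denotes the actions of the players other than $i$. $\mathbf{X}$ is an $\epsilon$-approximate correlated equilibrium if $\max_{\phi:[m]\to[m]}\big(u_i^{(\phi)}(\mathbf{X})-u_i(\mathbf{X})\big)\le\epsilon$ for every $i\in[n]$. Queries. A (possibly adaptive) algorithm accesses the game only through profile queries: a profile query of a pure action profile $\mathbf{a}$ returns the vector $(u_i(\mathbf{a}))_{i\in[n]}$. The deterministic profile query complexity of finding $\epsilon$-approximate correlated equilibria is the minimum, over deterministic algorithms that on every $n$-player, $m$-action game output an $\epsilon$-approximate correlated equilibrium, of the worst-case number of profile queries made. The asymptotics are as $n\to\infty$ with $m$ and $\epsilon$ fixed; the constant in $\Omega$ may depend on $m$ and $\epsilon$. *)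

(* Defs.v *)
From HB Require Import structures.
From mathcomp Require Import all_boot all_order all_algebra.
From mathcomp Require Import all_classical all_reals all_analysis.

Set Implicit Arguments.
Unset Strict Implicit.
Unset Printing Implicit Defensive.

Import Order.TTheory GRing.Theory Num.Theory.
Import numFieldNormedType.Exports.

Local Open Scope classical_set_scope.
Local Open Scope ring_scope.

Definition profile (n m : nat) : finType := {ffun 'I_n -> 'I_m}.

Record game (R : realType) (n m : nat) := Game {
  payoff :> 'I_n -> profile n m -> R;
  payoff_range : forall i a, 0 <= payoff i a <= 1 }.

Record correlated_profile (R : realType) (n m : nat) := CorrelatedProfile {
  mass :> {ffun profile n m -> R};
  mass_ge0 : forall a, 0 <= mass a;
  mass_sum1 : \sum_(a : profile n m) mass a = 1 }.

(* The profile (phi(a_i), a_{-i}). *)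
Definition deviate (n m : nat) (i : 'I_n) (phi : 'I_m -> 'I_m)
    (a : profile n m) : profile n m :=
  [ffun j => if j == i then phi (a j) else a j].

Definition expected_payoff (R : realType) (n m : nat) (u : game R n m)
    (i : 'I_n) (X : correlated_profile R n m) : R :=
  \sum_(a : profile n m) X a * u i a.

Definition deviation_payoff (R : realType) (n m : nat) (u : game R n m)
    (i : 'I_n) (phi : 'I_m -> 'I_m) (X : correlated_profile R n m) : R :=
  \sum_(a : profile n m) X a * u i (deviate i phi a).

Definition approx_correlated_eq (R : realType) (n m : nat) (eps : R)
    (u : game R n m) (X : correlated_profile R n m) : Prop :=
  forall (i : 'I_n) (phi : 'I_m -> 'I_m),
    deviation_payoff u i phi X - expected_payoff u i X <= eps.

(* Deterministic adaptive algorithms as decision trees: after the query [a],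
   the algorithm continues according to the answer (u_i(a))_i.  Trees are
   well-founded, so every run terminates, but as the branching is infinite the
   number of queries need not be bounded. *)
Inductive algorithm (R : realType) (n m : nat) : Type :=
  | Output of correlated_profile R n m
  | Query of profile n m & ({ffun 'I_n -> R} -> algorithm R n m).

Fixpoint output (R : realType) (n m : nat) (A : algorithm R n m)
    (u : game R n m) : correlated_profile R n m :=
  match A with
  | Output X => X
  | Query a next => output (next [ffun i => u i a]) u
  end.

Fixpoint nb_queries (R : realType) (n m : nat) (A : algorithm R n m)
    (u : game R n m) : nat :=
  match A with
  | Output _ => 0%N
  | Query a next => (nb_queries (next [ffun i => u i a]) u).+1
  end.

Definition finds_approx_correlated_eq (R : realType) (n m : nat) (eps : R)
    (A : algorithm R n m) : Prop :=
  forall u : game R n m, approx_correlated_eq eps u (output A u).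

Definition worst_case_queries (R : realType) (n m : nat)
    (A : algorithm R n m) : \bar R :=
  ereal_sup [set (nb_queries A u)%:R%:E | u in [set: game R n m]].

(* Equal to +oo when no algorithm is correct, e.g. for eps < 0 < n. *)
Definition query_complexity (R : realType) (n m : nat) (eps : R) : \bar R :=
  ereal_inf [set worst_case_queries A
            | A in [set A : algorithm R n m | finds_approx_correlated_eq eps A]].

(* Main.v *)
(* An adversary keeps a set C of profiles with 0/1 payoffs containing all the
   queried ones.  A profile with more than 2 l directions in which another
   point of its line lies in C is added to C; since a set of at most 2^l
   profiles has a point with at most l such directions (isoperimetry in the
   Hamming graph), C stays of size at most 2 q after q < 2^(l-1) queries.
   Payoffs are chosen so that every line in direction i contains at most one
   point of C paying 0 to i, while each point of C pays 1 to at most 3 l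
   players.  Once the output X is known, a profile a outside C pays
   [a_i = k] to each i.  Up to O(l) directions per profile, the deviation of
   i to the constant action k then gains (m-1)/m on average over i and k,
   so eps >= (m-1)/m - O(l/n), which fails for l a small multiple of n. *)
Require Import Defs.
From HB Require Import structures.
From mathcomp Require Import all_boot all_order all_algebra.
From mathcomp Require Import all_classical all_reals all_analysis.
From mathcomp Require Import zify ring lra.
From mathcomp Require Import fintype finset.

Import Order.TTheory GRing.Theory Num.Theory.
Import numFieldNormedType.Exports.

Set Implicit Arguments.
Unset Strict Implicit.
Unset Printing Implicit Defensive.

(** * Lines of the Hamming graph and isoperimetry *)

(** Erasing coordinate [i] makes lines values of a finite type, so that they can be counted as an
    image. *)
Definition line n m (i : 'I_n) (v : profile n m) : {ffun 'I_n -> option 'I_m} :=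
  [ffun j => if j == i then None else Some (v j)].

Definition line_dirs n m (S : {set profile n m}) (v : profile n m) : {set 'I_n} :=
  [set i | line i v \in [set line i w | w in S :\ v]].

(* Adding a point to S increases this by its number of line directions. *)
Definition excess n m (S : {set profile n m}) : nat :=
  \sum_(i < n) (#|S| - #|[set line i w | w in S]|).

Lemma line_eqP n m (i : 'I_n) (v w : profile n m) :
  line i v = line i w <-> forall j, j != i -> v j = w j.
Proof.
split=> [/ffunP e j ji|e]; last first.
  by apply/ffunP=> j; rewrite !ffunE; case: eqVneq => // ji; rewrite e.
by have := e j; rewrite !ffunE (negbTE ji) => -[].
Qed.

Lemma line_dirsP n m (S : {set profile n m}) (v : profile n m) (i : 'I_n) :
  reflect (exists w, [/\ w \in S, w != v & line i v = line i w])
    (i \in line_dirs S v).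
Proof.
rewrite inE; apply: (iffP imsetP) => [[w]|[w [wS wv e]]].
  by rewrite !inE => /andP[wv wS] e; exists w.
by exists w; rewrite // !inE wv.
Qed.

(** A neighbour of [v] along a direction other than [i] shares its coordinate [i], so the slice
    keeps it. *)
Lemma line_dirs_slice n m (S : {set profile n m}) (P : pred 'I_m) (i : 'I_n)
    (v : profile n m) : P (v i) ->
  line_dirs S v \subset i |: line_dirs [set w in S | P (w i)] v.
Proof.
move=> Pv; apply/subsetP => j /line_dirsP[w [wS wv e]].
rewrite in_setU1; case: eqVneq => //= ji.
apply/line_dirsP; exists w; split=> //; rewrite inE wS /=.
by move/line_eqP: e => <- //; rewrite eq_sym.
Qed.

(* Two slices of S across a direction of v are nonempty and lose only that
   direction. *)
Lemma min_line_dirs n m d (S : {set profile n m}) :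
  S != set0 -> (forall v, v \in S -> d <= #|line_dirs S v|) -> 2 ^ d <= #|S|.
Proof.
elim: d S => [|d IHd] S; first by rewrite card_gt0.
case/set0Pn=> v vS degS.
have /card_gt0P[i /line_dirsP[w [wS wv /line_eqP e]]] :
  0 < #|line_dirs S v| by apply: leq_trans (degS v vS).
have wvi : w i != v i.
  apply: contraNneq wv => wvi; apply/eqP/ffunP => j.
  by case: (eqVneq j i) => [->|/e].
have slice (P : pred 'I_m) x : x \in S -> P (x i) ->
    2 ^ d <= #|[set y in S | P (y i)]|.
  move=> xS Px; apply: IHd; first by apply/set0Pn; exists x; rewrite inE xS.
  move=> y; rewrite inE => /andP[yS Py].
  have := leq_trans (degS y yS) (subset_leq_card (line_dirs_slice S Py)).
  rewrite cardsU1; lia.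
rewrite -(cardsID [set y : profile n m | y i == v i] S) expnS mul2n -addnn leq_add //.
  have := slice (pred1 (v i)) v vS (eqxx _); congr (_ <= _).
  by apply: eq_card => y; rewrite !inE.
have := slice (predC1 (v i)) w wS wvi; congr (_ <= _).
by apply: eq_card => y; rewrite !inE andbC.
Qed.

Lemma sparse_low_vertex n m l (S : {set profile n m}) :
  S != set0 -> #|S| <= 2 ^ l -> exists2 v, v \in S & #|line_dirs S v| <= l.
Proof.
move=> S0 Sl; case: (boolP [exists v in S, #|line_dirs S v| <= l]).
  by case/exists_inP => v; exists v.
rewrite negb_exists_in => /forall_inP high.
have : 2 ^ l.+1 <= #|S|.
  by apply: min_line_dirs => // v /high; rewrite -ltnNge.
have : 0 < 2 ^ l by rewrite expn_gt0.
rewrite expnS; lia.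
Qed.

Lemma line_dirsD1 n m (S : {set profile n m}) (v : profile n m) :
  line_dirs (S :\ v) v = line_dirs S v.
Proof. by rewrite /line_dirs setDDl setUid. Qed.

Lemma excessU1 n m (S : {set profile n m}) (v : profile n m) :
  v \notin S -> excess (v |: S) = excess S + #|line_dirs S v|.
Proof.
move=> vS; rewrite -sum1_card big_mkcond -big_split /=; apply: eq_bigr => i _.
rewrite cardsU1 vS imsetU1 cardsU1.
have -> : (i \in line_dirs S v) = (line i v \in [set line i w | w in S]).
  by rewrite inE; have -> : S :\ v = S by apply/setDidPl; rewrite disjoint_sym disjoints1.
(* Keeps the truncated subtraction in [excess] exact. *)
have : #|[set line i w | w in S]| <= #|S| by apply: leq_imset_card.
case: (_ \in _) => /=; lia.
Qed.

(** Peel off points with at most [l] directions one at a time; each removal lowers the excess by at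
    most [l]. *)
Lemma excess_bound n m l (S : {set profile n m}) :
  #|S| <= 2 ^ l -> excess S <= l * #|S|.
Proof.
move: {2}#|S| (leqnn #|S|) => k; elim: k S => [|k IHk] S Sk Sl.
  have -> : S = set0 by apply/eqP; rewrite -cards_eq0; lia.
  by rewrite /excess cards0 big1.
have [->|S0] := eqVneq S set0; first by rewrite /excess cards0 big1.
have [v vS degv] := sparse_low_vertex S0 Sl.
have cS := cardsD1 v S; rewrite vS in cS.
have le : excess (S :\ v) <= l * #|S :\ v| by apply: IHk; lia.
rewrite -{1}(setD1K vS) excessU1 ?setD11 // line_dirsD1; lia.
Qed.

(** The same peeling: a pair on a line is charged to whichever point is peeled first, which receives
    all its directions in what is left. *)
Lemma sparse_orientation n m l (S : {set profile n m}) :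
  #|S| <= 2 ^ l -> exists o : profile n m -> {set 'I_n},
    (forall v, #|o v| <= l) /\
    (forall i v w, v \in S -> w \in S -> v != w -> line i v = line i w ->
       (i \in o v) || (i \in o w)).
Proof.
move: {2}#|S| (leqnn #|S|) => k; elim: k S => [|k IHk] S Sk Sl.
  have -> : S = set0 by apply/eqP; rewrite -cards_eq0; lia.
  by exists (fun=> set0); split=> [v|i v w]; rewrite ?cards0 ?inE.
have [->|S0] := eqVneq S set0.
  by exists (fun=> set0); split=> [v|i v w]; rewrite ?cards0 ?inE.
have [x xS degx] := sparse_low_vertex S0 Sl.
have cS := cardsD1 x S; rewrite xS in cS.
have [||o [ol oS]] := IHk (S :\ x); try lia.
exists (fun v => if v == x then line_dirs S x else o v); split.
  by move=> v; case: ifP.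
move=> i v w vS wS vw e; case: (eqVneq v x) => [vx|vx]; case: (eqVneq w x) => [wx|wx].
- by rewrite vx wx eqxx in vw.
- by apply/orP; left; apply/line_dirsP; exists w; rewrite -vx eq_sym.
- by apply/orP; right; apply/line_dirsP; exists v; rewrite -wx.
- by apply: oS => //; rewrite !inE ?vx ?wx.
Qed.

(** * The adversary's invariant and its maintenance *)

(* Each query costs at most 2 l, and each point added to close C pays for
   itself through the excess. *)
Definition few_points n m l q (C : {set profile n m}) : bool :=
  (2 * l * #|C| <= excess C + 2 * l * q) && (#|C| <= 2 ^ l).

(** [excess_bound] turns the invariant into [2 * l * #|C| <= l * #|C| + 2 * l * q]. *)
Lemma few_points_card n m l q (C : {set profile n m}) :
  0 < l -> few_points l q C -> #|C| <= 2 * q.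
Proof.
move=> l0 /andP[le Cl]; have := excess_bound Cl => eC.
rewrite -(leq_pmul2l l0); lia.
Qed.

(** To a maximal superset with the invariant, a point with more than [2 * l] directions could still
    be added: its excess pays for it, and [2 * q < 2 ^ l] leaves room. *)
Lemma few_points_closure n m l q (C : {set profile n m}) :
  0 < l -> 2 * q < 2 ^ l -> few_points l q C ->
  exists D : {set profile n m}, [/\ C \subset D, few_points l q D &
    forall w, w \notin D -> #|line_dirs D w| <= 2 * l].
Proof.
move=> l0 ql CA.
have [D /maxsetP[DA Dmax] CD] := maxset_exists CA.
exists D; split=> // w wD; rewrite leqNgt; apply/negP => deg.
have cD := few_points_card l0 DA.
have := Dmax (w |: D); rewrite /few_points excessU1 // cardsU1 wD subsetU1.
case/andP: DA => le _ e.
by move: wD; rewrite -e ?setU11 //; lia.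
Qed.

(* [o v] is the set of players paid 1 at [v]. *)
Definition adversary_state n m l q (C : {set profile n m})
    (o : profile n m -> {set 'I_n}) : Prop :=
  [/\ few_points l q C,
      forall w, w \notin C -> #|line_dirs C w| <= 2 * l,
      forall v, v \in C -> #|o v| <= 3 * l &
      forall i v w, v \in C -> w \in C -> v != w -> line i v = line i w ->
        (i \in o v) || (i \in o w)].

Lemma adversary_state0 n m l : @adversary_state n m l 0 set0 (fun=> set0).
Proof.
split=> [|w _|v|i v w]; rewrite ?inE // ?/few_points ?cards0 ?expn_gt0 ?muln0 //.
rewrite [line_dirs _ _](_ : _ = set0) ?cards0 //.
by apply/setP => i; rewrite !inE set0D imset0 inE.
Qed.

Lemma adversary_answer n m l q (C : {set profile n m}) o a :
  0 < l -> 2 * q.+1 < 2 ^ l -> adversary_state l q C o ->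
  exists D o', [/\ adversary_state l q.+1 D o', a \in D, C \subset D &
    {in C, o =1 o'}].
Proof.
move=> l0 ql [CA Cdeg oC Co].
have aCA : few_points l q.+1 (a |: C).
  have cC := few_points_card l0 CA; move: CA => /andP[le Cl].
  case: (boolP (a \in C)) => aC.
    by rewrite (setUidPr _) ?sub1set // /few_points Cl andbT; lia.
  by rewrite /few_points excessU1 // cardsU1 aC; lia.
have [D [/subUsetP[aD CD] DA Ddeg]] := few_points_closure l0 ql aCA.
rewrite sub1set in aD.
have [|ord [ordl ordD]] := @sparse_orientation _ _ l (D :\: C).
  by case/andP: DA => _; apply: leq_trans; rewrite subset_leq_card ?subsetDl.
(* New points pay 1 along their directions to [C], at most [2 * l], and by an orientation of
   [D :\: C], at most [l] more; old points keep their payoffs. *)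
exists D, (fun v => if v \in C then o v else line_dirs C v :|: ord v).
split=> //; last by move=> v ->.
split=> // [v vD|i v w vD wD vw e].
  case: ifPn => vC; first exact: oC.
  by apply: leq_trans (leq_card_setU _ _) _; have := Cdeg v vC; have := ordl v; lia.
case: ifPn => vC; case: ifPn => wC; rewrite ?in_setU.
- exact: Co e.
- have -> : i \in line_dirs C w by apply/line_dirsP; exists v.
  by rewrite orbT.
- have -> // : i \in line_dirs C v.
  by apply/line_dirsP; exists w; rewrite eq_sym.
- have : (i \in ord v) || (i \in ord w) by apply: ordD; rewrite ?inE ?vC ?wC.
  by case/orP=> ->; rewrite !orbT.
Qed.

(** * Running an algorithm against the adversary *)

Local Open Scope ring_scope.

Lemma bool_range (R : realType) (b : bool) : 0 <= (b%:R : R) <= 1.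
Proof. by case: b; rewrite ?lexx ?ler01. Qed.

Definition completion (R : realType) n m (C : {set profile n m})
    (o : profile n m -> {set 'I_n}) (g : 'I_n -> profile n m -> bool) :
  game R n m :=
  Game (fun i a => bool_range R (if a \in C then i \in o a else g i a)).

Definition consistent (R : realType) n m (C : {set profile n m})
    (o : profile n m -> {set 'I_n}) (u : game R n m) : Prop :=
  forall a i, a \in C -> u i a = (i \in o a)%:R.

Lemma completion_consistent (R : realType) n m (C : {set profile n m}) o g :
  consistent C o (completion R C o g).
Proof. by move=> a i aC /=; rewrite aC. Qed.

(** All games consistent with the enlarged set answer the query alike, so [A] follows a single
    branch to a fixed output. *)
Lemma adversary_run (R : realType) n m l K (A : algorithm R n m) q
    (C : {set profile n m}) o :
  (0 < l)%N -> (2 * K < 2 ^ l)%N -> adversary_state l q C o ->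
  (forall u, consistent C o u -> (nb_queries A u + q <= K)%N) ->
  exists r (D : {set profile n m}) o' X, adversary_state l r D o' /\
    forall u, consistent D o' u -> consistent C o u /\ output A u = X.
Proof.
move=> l0 Kl; elim: A q C o => [X|a next IH] q C o st nbK.
  by exists q, C, o, X.
(* Some game is consistent with [C], so the budget [K] covers this query too. *)
have qK : (q.+1 <= K)%N.
  have /nbK : consistent C o (completion R C o (fun _ _ => false)).
    exact: completion_consistent.
  by apply: leq_trans; rewrite /= addSn ltnS leq_addl.
have [|D [ord [stD aD CD oord]]] := adversary_answer a l0 _ st; first by lia.
have consD u : consistent D ord u -> consistent C o u.
  by move=> Du b i bC; rewrite Du ?(fintype.subsetP CD) // oord.
have answer u : consistent D ord u ->
    [ffun i => u i a] = [ffun i => (i \in ord a)%:R] :> {ffun 'I_n -> R}.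
  by move=> Du; apply/ffunP => i; rewrite !ffunE Du.
have [|r [E [ordE [X [stE outX]]]]] := IH [ffun i => (i \in ord a)%:R] _ _ _ stD.
  by move=> u Du; rewrite -(answer u Du) addnS -addSn; apply/nbK/consD.
exists r, E, ordE, X; split=> // u /outX[Du <-].
by rewrite /= (answer u Du); split=> //; apply: consD.
Qed.

(** * Regret of a fixed output *)

Lemma line_deviate n m (i : 'I_n) phi (a : profile n m) :
  line i (deviate i phi a) = line i a.
Proof. by apply/line_eqP => j ji; rewrite ffunE (negbTE ji). Qed.

(* The players whose line through [a] does not yield the full gain. *)
Definition spoiled n m (C : {set profile n m}) (o : profile n m -> {set 'I_n})
    (a : profile n m) : {set 'I_n} :=
  if a \in C then o a else line_dirs C a.

(** These games agree on [C] for all [k], so a single output has to serve every [k]. *)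
Definition target_game (R : realType) n m (C : {set profile n m}) o (k : 'I_m) :
  game R n m := completion R C o (fun i a => a i == k).

(** For [i] not spoiled: if [a] is in [C], it pays 0 while moving to [k <> a i] pays 1; otherwise
    the line avoids [C] and only the target [k] pays. *)
Lemma target_gain (R : realType) n m l q (C : {set profile n m}) o i a :
  adversary_state l q C o ->
  m%:R - 1 - (2 * m)%:R * (i \in spoiled C o a)%:R <=
  \sum_(k < m) (target_game R C o k i (deviate i (fun=> k) a)
                - target_game R C o k i a).
Proof.
case=> _ _ _ Co.
have [bad|good] := boolP (i \in _).
  (* Each of the [m] differences is at least -1, and [-m] exceeds [m - 1 - 2 * m] by 1. *)
  have -> : m%:R - 1 - (2 * m)%:R * 1 = \sum_(k < m) (-1) - 1 :> R.
    by rewrite sumr_const card_ord -mulr_natl natrM; ring.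
  apply: (@le_trans _ _ (\sum_(k < m) (-1 : R))); first by rewrite lerBlDr lerDl.
  apply: ler_sum => k _.
  have /andP[] := payoff_range (target_game R C o k) i a.
  have /andP[] := payoff_range (target_game R C o k) i (deviate i (fun=> k) a).
  lra.
rewrite mulr0 subr0.
have -> : m%:R - 1 = \sum_(k < m) (1 - (k == a i)%:R) :> R.
  rewrite sumrB sumr_const card_ord; congr (_ - _).
  by rewrite (bigD1 (a i)) //= eqxx big1 ?addr0 // => k /negbTE->.
apply: ler_sum => k _ /=.
have devk : deviate i (fun=> k) a i = k by rewrite ffunE eqxx.
move: good; rewrite /spoiled; case: ifPn => aC ioa.
  rewrite (negbTE ioa) subr0; case: eqVneq => [->|ka].
    by rewrite subrr; case/andP: (bool_range R (if deviate i (fun=> a i) a \in C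
      then i \in o (deviate i (fun=> a i) a) else deviate i (fun=> a i) a i == a i)).
  rewrite subr0 devk eqxx; case: ifPn => // dC.
  have := Co i a (deviate i (fun=> k) a) aC dC.
  rewrite line_deviate (negbTE ioa) /= => -> //.
  by apply: contra_neq ka => ->.
rewrite (ifN _ _ (_ : deviate i (fun=> k) a \notin C)) ?devk ?eqxx 1?eq_sym //.
apply: contra ioa => dC; apply/line_dirsP; exists (deviate i (fun=> k) a).
by rewrite line_deviate; split=> //; apply: contraNneq aC => <-.
Qed.

(** Sum the constant deviations over all [i] and [k]; at each profile at most [3 * l] spoiled
    players lose [2 * m] each, whence [6 * m * l]. *)
Lemma regret_lower_bound (R : realType) n m l q (C : {set profile n m}) o
    (eps : R) (X : correlated_profile R n m) :
  adversary_state l q C o ->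
  (forall k, approx_correlated_eq eps (target_game R C o k) X) ->
  (m%:R - 1) * n%:R - (6 * m * l)%:R <= n%:R * (m%:R * eps).
Proof.
move=> st eqX.
have spoiled_le a : (#|spoiled C o a| <= 3 * l)%N.
  by case: st => _ Cdeg oC _; rewrite /spoiled; case: ifPn => [/oC //|/Cdeg]; lia.
have <- : \sum_(i < n) \sum_(k < m) eps = n%:R * (m%:R * eps).
  by rewrite !sumr_const !card_ord !mulr_natl.
apply: (@le_trans _ _ (\sum_(i < n) \sum_(k < m)
  (deviation_payoff (target_game R C o k) i (fun=> k) X
   - expected_payoff (target_game R C o k) i X))); last first.
  by apply: ler_sum => i _; apply: ler_sum => k _; apply: eqX.
have -> : \sum_(i < n) \sum_(k < m)
  (deviation_payoff (target_game R C o k) i (fun=> k) X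
   - expected_payoff (target_game R C o k) i X) =
  \sum_a X a * \sum_(i < n) \sum_(k < m)
    (target_game R C o k i (deviate i (fun=> k) a) - target_game R C o k i a).
  under [RHS]eq_bigr => a _ do rewrite mulr_sumr.
  rewrite [RHS]exchange_big; apply: eq_bigr => i _.
  under [RHS]eq_bigr => a _ do rewrite mulr_sumr.
  rewrite [RHS]exchange_big; apply: eq_bigr => k _.
  by rewrite -sumrB; apply: eq_bigr => a _; rewrite mulrBr.
(* Masses sum to 1, so the bound can be proved profile by profile. *)
have avg c : c = \sum_a X a * c by rewrite -mulr_suml mass_sum1 mul1r.
rewrite [leLHS]avg; apply: ler_sum => a _.
apply: ler_wpM2l; first exact: mass_ge0.
apply: (@le_trans _ _ (\sum_(i < n)
  (m%:R - 1 - (2 * m)%:R * (i \in spoiled C o a)%:R))); last first.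
  by apply: ler_sum => i _; apply: target_gain st.
rewrite sumrB sumr_const card_ord -[(m%:R - 1) *+ n]mulr_natr lerB //.
rewrite -mulr_sumr -natr_sum -natrM ler_nat -mulnA mulnA.
have -> : (\sum_(i < n) (i \in spoiled C o a) = #|spoiled C o a|)%N.
  by rewrite -sum1_card [RHS]big_mkcond; apply: eq_bigr => i _; case: (_ \in _).
have := spoiled_le a; nia.
Qed.

(** * Choice of constants and conclusion *)

Local Open Scope classical_set_scope.
Local Open Scope ring_scope.

Theorem theorem7 (R : realType) (m : nat) (eps : R) :
  (0 < m)%N -> eps < (m%:R - 1) / m%:R ->
  exists c : R, 0 < c /\
    \forall n \near \oo,
      ((2 `^ (c * n%:R))%:E <= query_complexity n m eps)%E.
Proof.
move=> m0 epsm.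
have mR0 : 0 < m%:R :> R by rewrite ltr0n.
pose gap : R := (m%:R - 1) / m%:R - eps.
have gap0 : 0 < gap by rewrite subr_gt0.
exists (gap / 14); split; first by rewrite divr_gt0.
near=> n.
(* 28 gives [gap * n / 14 <= gap * n / 7 - 2 < l - 1], which absorbs the rounding of [l]. *)
have n_large : 28 <= gap * n%:R.
  rewrite -ler_pdivrMl // mulrC; near: n; exact: nbhs_infty_ger.
(* The 7 beats the 6 in [regret_lower_bound], which after cancelling [m] says [gap * n <= 6 * l]. *)
pose l := Num.truncn (gap / 7 * n%:R).
have gn0 : 0 <= gap / 7 * n%:R by rewrite mulr_ge0 // ltW // divr_gt0.
have /andP[l_le lt_l] := truncn_itv gn0.
rewrite -/l -[l.+1]addn1 natrD in l_le lt_l.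
have l0 : (0 < l)%N by rewrite -(ltr_nat R); lra.
apply: le_ereal_inf_tmp => _ [A Acorrect <-].
rewrite leNgt; apply/negP => few.
(* The budget is one less than [2 ^ l.-1], so that its double stays below [2 ^ l]. *)
have nbA u : (nb_queries A u + 0 <= 2 ^ l.-1 - 1)%N.
  have : ((nb_queries A u)%:R%:E < (2 `^ (gap / 14 * n%:R))%:E :> \bar R)%E.
    by apply: le_lt_trans few; apply: ereal_sup_ubound; exists u.
  rewrite lte_fin => lt_nb.
  have : (nb_queries A u)%:R < (2 ^ l.-1)%:R :> R.
    apply: lt_le_trans lt_nb _; rewrite natrX -powR_mulrn // ler_powR ?ler1n //.
    rewrite -subn1 natrB //; lra.
  rewrite ltr_nat; lia.
have [|r [D [ord [X [st out]]]]] :=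
    adversary_run l0 _ (@adversary_state0 n m l) (fun u _ => nbA u).
  have : (0 < 2 ^ l.-1)%N by rewrite expn_gt0.
  have : (2 ^ l = 2 * 2 ^ l.-1)%N by rewrite -expnS prednK.
  lia.
have := @regret_lower_bound R n m l r D ord eps X st.
have -> : (6 * m * l)%:R = m%:R * (6 * l%:R) :> R by rewrite !natrM; ring.
have -> : (m%:R - 1) = m%:R * (eps + gap) by rewrite /gap; field; rewrite gt_eqF.
rewrite -mulrA -mulrBr [n%:R * _]mulrCA ler_pM2l // => le_eps.
have /le_eps : forall k, approx_correlated_eq eps (target_game R D ord k) X.
  by move=> k; have [_ <-] := out _ (@completion_consistent R n m D ord (fun i a => a i == k)).
move: l_le; lra.
Unshelve. all: by end_near.
Qed.
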